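(* Let $V$ be a vector space over $\mathbb{C}$ with finite positive dimension and let $A,A^*$ be a tridiagonal pair on $V$ of diameter $d$, with orderings $V_0,\ldots,V_d$ of the eigenspaces of $A$ and $V^*_0,\ldots,V^*_d$ of the eigenspaces of $A^*$ as in the definition of a tridiagonal pair. Assume that there exists a positive definite Hermitian form $(\,,\,)$ on $V$ such that $(Au,v)=(u,Av)$ and $(A^*u,v)=(u,A^*v)$ for all $u,v\in V$. For $0\le i\le d$ define $$U^{\downarrow\downarrow}_i=(V^*_0+\cdots+V^*_i)\cap(V_0+\cdots+V_{d-i}),\qquad U^{\uparrow\downarrow}_i=(V^*_{d-i}+\cdots+V^*_d)\cap(V_0+\cdots+V_{d-i}),$$ $$U^{\downarrow\uparrow}_i=(V^*_0+\cdots+V^*_i)\cap(V_i+\cdots+V_d),\qquad U^{\uparrow\uparrow}_i=(V^*_{d-i}+\cdots+V^*_d)\cap(V_i+\cdots+V_d).$$ Then the following (i), (ii) hold for all $0\le i,j\le d$ such that $i+j\ne d$. (i) The subspaces $U^{\downarrow\downarrow}_i$ and $U^{\uparrow\uparrow}_j$ are orthogonal with respect to $(\,,\,)$. (ii) The subspaces $U^{\downarrow\uparrow}_i$ and $U^{\uparrow\downarrow}_j$ are orthogonal with respect to $(\,,\,)$.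
   Context: A tridiagonal pair on $V$ is an ordered pair $A,A^*$ of $\mathbb{C}$-linear maps $V\to V$ such that: (1) $A$ and $A^*$ are both diagonalizable on $V$; (2) there is an ordering $V_0,V_1,\ldots,V_d$ of the eigenspaces of $A$ such that $A^*V_i\subseteq V_{i-1}+V_i+V_{i+1}$ for $0\le i\le d$, where $V_{-1}=V_{d+1}=0$; (3) there is an ordering $V^*_0,V^*_1,\ldots,V^*_\delta$ of the eigenspaces of $A^*$ such that $AV^*_i\subseteq V^*_{i-1}+V^*_i+V^*_{i+1}$ for $0\le i\le\delta$, where $V^*_{-1}=V^*_{\delta+1}=0$; (4) there is no subspace $W$ of $V$ with $AW\subseteq W$ and $A^*W\subseteq W$ other than $W=0$ and $W=V$. Here $A^*$ is just a name for a second linear map; it does not denote the conjugate-transpose of $A$. Eigenspaces are nonzero subspaces of the form $\{v\in V: Av=\theta v\}$, one for each eigenvalue $\theta$. It is known that $d=\delta$; this common value is the diameter of the pair. A Hermitian form on $V$ is a function $(\,,\,):V\times V\to\mathbb{C}$ that is additive and $\mathbb{C}$-linear in the first argument and satisfies $(v,u)=\overline{(u,v)}$; it is positive definite if $(v,v)>0$ for all nonzero $v\in V$. *)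

(* Defs.v *)
From HB Require Import structures.
From mathcomp Require Import all_boot all_order all_algebra.
From mathcomp Require Import reals complex.

Set Implicit Arguments.
Unset Strict Implicit.
Unset Printing Implicit Defensive.

Import Order.TTheory GRing.Theory Num.Theory.
Local Open Scope ring_scope.

Section TridiagonalPair.
Variables (F : fieldType) (V : vectType F).
Implicit Types (A B : 'End(V)) (W : {vspace V}).

Definition end_diagonalizable A : Prop :=
  exists2 X : seq V, basis_of fullv X &
    {in X, forall x, exists a, x \in passmx.leigenspace A a}.

(* [Vs] lists every eigenspace of [A] exactly once. *)
Definition eigenspace_ordering d A (Vs : 'I_d.+1 -> {vspace V}) : Prop :=
  injective Vs /\
  forall W, (exists i, W = Vs i) <->
            (exists2 a, passmx.leigenvalue A a & W = passmx.leigenspace A a).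

(* The sum ranges over the indices j in [0, d] with |i - j| <= 1; leaving out
   the out-of-range ones implements the convention V_{-1} = V_{d+1} = 0. *)
Definition tridiagonal_action d B (Vs : 'I_d.+1 -> {vspace V}) : Prop :=
  forall i : 'I_d.+1,
    (B @: Vs i <= \sum_(j < d.+1 | (i <= j.+1)%N && (j <= i.+1)%N) Vs j)%VS.

Definition standard_ordering d A B (Vs : 'I_d.+1 -> {vspace V}) : Prop :=
  eigenspace_ordering A Vs /\ tridiagonal_action B Vs.

Definition irreducible_pair A B : Prop :=
  forall W, (A @: W <= W)%VS -> (B @: W <= W)%VS -> W = 0%VS \/ W = fullv.

Definition tridiagonal_pair A B : Prop :=
  [/\ end_diagonalizable A /\ end_diagonalizable B,
      exists d (Vs : 'I_d.+1 -> {vspace V}), standard_ordering A B Vs,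
      exists delta (Vss : 'I_delta.+1 -> {vspace V}), standard_ordering B A Vss
    & irreducible_pair A B].

(* In the names below the first arrow refers to the eigenspaces [Vss] of the
   second map, and the second arrow to the eigenspaces [Vs] of the first. *)
Section SplitSubspaces.
Variables (d : nat) (Vs Vss : 'I_d.+1 -> {vspace V}) (i : 'I_d.+1).

Definition Udown_down : {vspace V} :=
  ((\sum_(k < d.+1 | (k <= i)%N) Vss k)
     :&: (\sum_(k < d.+1 | (k <= d - i)%N) Vs k))%VS.

Definition Uup_down : {vspace V} :=
  ((\sum_(k < d.+1 | (d - i <= k)%N) Vss k)
     :&: (\sum_(k < d.+1 | (k <= d - i)%N) Vs k))%VS.

Definition Udown_up : {vspace V} :=
  ((\sum_(k < d.+1 | (k <= i)%N) Vss k)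
     :&: (\sum_(k < d.+1 | (i <= k)%N) Vs k))%VS.

Definition Uup_up : {vspace V} :=
  ((\sum_(k < d.+1 | (d - i <= k)%N) Vss k)
     :&: (\sum_(k < d.+1 | (i <= k)%N) Vs k))%VS.

End SplitSubspaces.
End TridiagonalPair.

Definition orthogonal_subspaces (F : fieldType) (V : vectType F)
    (form : V -> V -> F) (U W : {vspace V}) : Prop :=
  {in U & W, forall u w, form u w = 0}.

(* Main.v *)
(** Eigenspaces of a self-adjoint map for distinct eigenvalues are orthogonal.
    If [i + j < d], the index ranges of the eigenspaces of the second map that
    enter the two split subspaces are disjoint; if [i + j > d], those of the
    first map are. *)
Require Import Defs.
From HB Require Import structures.
From mathcomp Require Import all_boot all_order all_algebra.
From mathcomp Require Import reals complex.

Set Implicit Arguments.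
Unset Strict Implicit.
Unset Printing Implicit Defensive.

Import Order.TTheory GRing.Theory Num.Theory.
Local Open Scope ring_scope.

Lemma mem_leigenspace (F : fieldType) (V : vectType F) (A : 'End(V)) a u :
  (u \in passmx.leigenspace A a) = (A u == a *: u).
Proof.
by rewrite memv_ker !lfunE /= !lfunE /= scale_lfunE id_lfunE subr_eq0.
Qed.

Section SelfAdjoint.
Variables (C : numClosedFieldType) (V : vectType C).
Variables (form : {dot V for Num.conj}) (A : 'End(V)).
Hypothesis A_sym : forall u v : V, form (A u) v = form u (A v).

(** Both sides equal [form (A u) v]. The conjugate appears because [form] is conjugate-linear in its
    second argument. *)
Lemma selfadjoint_form_eigenvectors a b u v :
  A u = a *: u -> A v = b *: v -> a * form u v = b^* * form u v.
Proof. by move=> Au Av; rewrite -linearZl_LR /= -Au A_sym Av linearZr_LR. Qed.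

(** Taking [v = u] above, positive definiteness makes [form u u] nonzero, so it cancels. *)
Lemma selfadjoint_eigenvalue_conj a u : A u = a *: u -> u != 0 -> a^* = a.
Proof.
move=> Au; rewrite -(dnorm_eq0 form) => uu_neq0.
by apply: (mulIf uu_neq0); rewrite (selfadjoint_form_eigenvectors Au Au).
Qed.

Lemma selfadjoint_eigenvectors_orthogonal a b u v :
  a != b -> A u = a *: u -> A v = b *: v -> form u v = 0.
Proof.
move=> a_neq_b Au Av; have [->|v_neq0] := eqVneq v 0; first by rewrite linear0r.
apply/eqP; have /eqP := selfadjoint_form_eigenvectors Au Av.
rewrite (selfadjoint_eigenvalue_conj Av v_neq0) -subr_eq0 -mulrBl mulf_eq0.
by rewrite subr_eq0 (negPf a_neq_b).
Qed.

Lemma eigenspaces_orthogonal d (Vs : 'I_d.+1 -> {vspace V}) i j :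
  eigenspace_ordering A Vs -> i != j -> orthogonal_subspaces form (Vs i) (Vs j).
Proof.
move=> [Vs_inj VsP] i_neq_j.
have [a _ Vi] : exists2 a, passmx.leigenvalue A a & Vs i = passmx.leigenspace A a.
  by apply/VsP; exists i.
have [b _ Vj] : exists2 a, passmx.leigenvalue A a & Vs j = passmx.leigenspace A a.
  by apply/VsP; exists j.
have a_neq_b : a != b.
  by apply: contra_neq i_neq_j => ab; apply: Vs_inj; rewrite Vi Vj ab.
move=> u v; rewrite Vi Vj !mem_leigenspace => /eqP Au /eqP Av.
exact: selfadjoint_eigenvectors_orthogonal Au Av.
Qed.

(** Expanding in both arguments leaves only pairs of components whose indices differ, since no index
    satisfies both [P] and [Q]. *)
Lemma sum_eigenspaces_orthogonal d (Vs : 'I_d.+1 -> {vspace V})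
    (P Q : pred 'I_d.+1) :
  eigenspace_ordering A Vs -> (forall k, P k -> ~~ Q k) ->
  orthogonal_subspaces form (\sum_(k | P k) Vs k)%VS (\sum_(k | Q k) Vs k)%VS.
Proof.
move=> VsP PQ _ _ /memv_sumP[u Vu ->] /memv_sumP[v Vv ->].
rewrite linear_sumlz big1 // => k Pk; rewrite linear_sumr big1 // => l Ql.
apply: (eigenspaces_orthogonal VsP _ (Vu k Pk) (Vv l Ql)).
by apply: contraTneq Ql => <-; apply: PQ.
Qed.

End SelfAdjoint.

Lemma orthogonal_subspacesS (F : fieldType) (V : vectType F)
    (form : V -> V -> F) (U1 U2 W1 W2 : {vspace V}) :
  (U1 <= U2)%VS -> (W1 <= W2)%VS ->
  orthogonal_subspaces form U2 W2 -> orthogonal_subspaces form U1 W1.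
Proof. by move=> /subvP sU /subvP sW oUW u w /sU Uu /sW Ww; apply: oUW. Qed.

Theorem theorem3p6 (R : realType) (V : vectType R[i])
    (V_gt0 : (0 < \dim {:V})%N)
    (A As : 'End(V)) (d : nat) (Vs Vss : 'I_d.+1 -> {vspace V})
    (TD : tridiagonal_pair A As)
    (hVs : standard_ordering A As Vs)
    (hVss : standard_ordering As A Vss)
    (form : {dot V for Num.conj})
    (A_sym : forall u v : V, form (A u) v = form u (A v))
    (As_sym : forall u v : V, form (As u) v = form u (As v))
    (i j : 'I_d.+1) (hij : (i + j)%N <> d) :
  orthogonal_subspaces form (Udown_down Vs Vss i) (Uup_up Vs Vss j) /\
  orthogonal_subspaces form (Udown_up Vs Vss i) (Uup_down Vs Vss j).
Proof.
have [Vs_ord _] := hVs; have [Vss_ord _] := hVss.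
have [ij_lt|ij_gt|//] := ltngtP (i + j)%N d.
  (* Claims (i) and (ii) involve the same two sums of [Vss], so one fact serves both: [k <= i] and
     [d - j <= k] exclude each other because [i < d - j]. *)
  have oVss := sum_eigenspaces_orthogonal As_sym
    (P := fun k => (k <= i)%N) (Q := fun k => (d - j <= k)%N) Vss_ord.
  split; apply: orthogonal_subspacesS (capvSl _ _) (capvSl _ _) _;
    apply: oVss => k ki; rewrite -ltnNge (leq_ltn_trans ki) //;
    by rewrite ltn_subRL addnC.
(* These bounds ensure that [d - i] and [d - j] are not truncated, as [ltn_subLR] requires. *)
have i_le_d : (i <= d)%N by rewrite -ltnS.
have j_le_d : (j <= d)%N by rewrite -ltnS.
(* The sums of [Vs] differ between the claims: (i) needs [d - i < j], (ii) needs [d - j < i]. *)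
split; apply: orthogonal_subspacesS (capvSr _ _) (capvSr _ _) _;
  apply: (sum_eigenspaces_orthogonal A_sym Vs_ord) => k ki; rewrite -ltnNge.
  by rewrite (leq_ltn_trans ki) // ltn_subLR.
by rewrite (leq_trans _ ki) // ltn_subLR // addnC.
Qed.
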